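(* Let $T$ be a tree rooted at $o$, let $X$ be either $\mathcal{L}_{\mathbf{w}}$ or $\mathcal{L}_{\mathbf{w},0}$, and let $\psi:T\to\mathbb{C}$ be such that $M_\psi$ is a bounded multiplication operator on $X$. Then (a) the point spectrum of $M_\psi$ on $X$ is $\sigma_p(M_\psi)=\psi(T)$; (b) the spectrum of $M_\psi$ on $X$ is $\sigma(M_\psi)=\overline{\psi(T)}$, the closure of the range of $\psi$ in $\mathbb{C}$.
   Context: A tree $T$ is a locally finite, connected, simply-connected graph, identified with its set of vertices; $T$ is assumed to have no terminal vertices (vertices with exactly one neighbor), so it is infinite, and it is rooted at a vertex $o$. $|v|$ is the number of edges in the unique path from $o$ to $v$; $T^*=T\setminus\{o\}$; for $v\in T^*$, $v^-$ is the neighbor of $v$ closest to $o$. For $f:T\to\mathbb{C}$ and $v\in T^*$, $Df(v)=|f(v)-f(v^-)|$. The weighted Lipschitz space $\mathcal{L}_{\mathbf{w}}$ is the set of $f:T\to\mathbb{C}$ with $\sup_{v\in T^*}|v|Df(v)<\infty$, normed by $\|f\|_{\mathbf{w}}=|f(o)|+\sup_{v\in T^*}|v|Df(v)$ (a Banach space). The little weighted Lipschitz space $\mathcal{L}_{\mathbf{w},0}$ is the closed subspace of those $f\in\mathcal{L}_{\mathbf{w}}$ with $\lim_{|v|\to\infty}|v|Df(v)=0$. $M_\psi f=\psi f$ (pointwise product); ''$M_\psi$ is bounded on $X$'' means $M_\psi$ maps $X$ into $X$ and is a bounded linear operator there. For a bounded operator $S$ on a Banach space $X$ with identity $I$: $\sigma(S)=\{\lambda\in\mathbb{C}: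 S-\lambda I\text{ is not invertible}\}$ and $\sigma_p(S)=\{\lambda\in\mathbb{C}:\ker(S-\lambda I)\ne\{0\}\}$. *)

(* Defs.v *)
From HB Require Import structures.
From mathcomp Require Import all_boot all_order all_algebra.
From mathcomp Require Import all_classical all_reals all_analysis.
From mathcomp Require Import complex.
Set Implicit Arguments.
Unset Strict Implicit.
Unset Printing Implicit Defensive.
Import Order.TTheory GRing.Theory Num.Theory numFieldNormedType.Exports.
Import complex.ComplexField.Normc.
Local Open Scope classical_set_scope.
Local Open Scope ring_scope.
Local Open Scope complex_scope.

(* The library puts a topology on the carrier of an abstract numClosedFieldType
   only; this transports it to the concrete complex numbers. *)
HB.instance Definition _ (R : realType) :=
  NormedModule.copy R[i] (R[i] : numClosedFieldType)^o.

Section BoundedOperators.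
Variables (K : numFieldType) (V : normedModType K).

Definition bounded_operator (S : V -> V) : Prop :=
  exists M : K, forall x, `|S x| <= M * `|x|.

Definition invertible_operator (S : V -> V) : Prop :=
  exists2 S' : {linear V -> V}, bounded_operator S' &
    cancel S S' /\ cancel S' S.

Definition spectrum (S : V -> V) : set K :=
  [set l | ~ invertible_operator (fun x => S x - l *: x)].

Definition point_spectrum (S : V -> V) : set K :=
  [set l | exists2 x, x != 0 & S x - l *: x = 0].

End BoundedOperators.

(* Cycles have at least 3 vertices, so that an edge traversed back and forth
   does not count as one.  [tree_infinite] only excludes the one-vertex tree. *)
Record rooted_tree := RootedTree {
  vertex :> choiceType;
  adj : rel vertex;
  root : vertex;
  adj_sym : symmetric adj;
  adj_irr : irreflexive adj;
  tree_locally_finite : forall v, finite_set [set w | adj v w];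
  tree_connected : forall u v, exists2 p, path adj u p & last u p = v;
  tree_acyclic : forall c, (2 < size c)%N -> ~ ucycle adj c;
  tree_no_terminal : forall v, ~ exists w, [set u | adj v u] = [set w];
  tree_infinite : infinite_set [set: vertex]
}.

Arguments root {_}.

Section TreeDistance.
Variable T : rooted_tree.
Implicit Types (u v w : T) (p q : seq T).

Definition simple_path u p v : Prop :=
  [/\ path (@adj T) u p, uniq (u :: p) & last u p = v].

Lemma simple_path_ex u v : exists p, simple_path u p v.
Proof.
have [p pp <-] := tree_connected u v.
by case/shortenP: pp => q pq uq _; exists q.
Qed.

Lemma simple_path_uniq u p q v :
  simple_path u p v -> simple_path u q v -> p = q.
Proof.
elim: p u q => [|a p IH] u [|b q] //.
- by case=> _ _ <- [_ /= /andP[+ _] lq]; rewrite -[u in u \notin _]lq mem_last.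
- by case=> _ /= /andP[+ _] lp [_ _ /= uv]; rewrite uv -lp mem_last.
move=> [pp up lp] [pq uq lq].
have [ab|ab] := eqVneq a b.
  subst b; congr cons; apply: (IH a).
    by move: pp up lp => /= /andP[_ ?] /andP[_ ?].
  by move: pq uq lq => /= /andP[_ ?] /andP[_ ?].
exfalso.
have hq : has (mem (a :: p)) (b :: q).
  apply/hasP; exists v; first by rewrite -lq; exact: (mem_last b q).
  by rewrite -[v]lp; exact: (mem_last a p).
have [z [q1 [q2 [eq_q zp nq1]]]] : exists z q1 q2, [/\ b :: q = rcons q1 z ++ q2,
    z \in a :: p & ~~ has (mem (a :: p)) q1].
  by case/split_find: hq => z q1 q2 zp nq1; exists z, q1, q2.
have [p1 [p2 eq_p]] : exists p1 p2, a :: p = rcons p1 z ++ p2.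
  by case/splitPr: zp => p1 p2; exists p1, p2; rewrite cat_rcons.
have c2 : (2 < size (u :: p1 ++ z :: rev q1))%N.
  rewrite /= size_cat /= size_rev.
  case: p1 eq_p => [|a1 p1] /= eq_p; last by rewrite addnS.
  case: q1 eq_q {nq1} => [|b1 q1] //= eq_q.
  by case: eq_p eq_q ab => -> _ [-> _]; rewrite eqxx.
apply: (@tree_acyclic T _ c2).
move: pp up pq uq nq1; rewrite eq_p eq_q => {c2 ab eq_p eq_q hq lp lq zp IH}.
rewrite !cat_path -!cat_cons !cat_uniq => /andP[pp _] /andP[up _] /andP[pq _].
move=> /andP[uq _] nq1.
apply/andP; split.
  change (path (@adj T) u (rcons (p1 ++ z :: rev q1) u)).
  rewrite rcons_cat rcons_cons -cat_rcons cat_path pp last_rcons /=.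
  have -> : rcons (rev q1) u = rev (belast u (rcons q1 z)).
    by rewrite belast_rcons rev_cons.
  by rewrite -[X in path _ X](last_rcons u q1 z) rev_path (eq_path (e' := @adj T)) // => x y; exact: adj_sym.
rewrite -cat_rcons cat_uniq up rev_uniq /=.
move: uq; rewrite /= rcons_uniq => /and3P[uq _ ->].
rewrite has_rev andbT; apply: contra nq1 => /hasP[x xq]; rewrite inE => /orP[/eqP xu|xp].
  by move: uq; rewrite mem_rcons inE -xu xq orbT.
by apply/hasP; exists x => //=; rewrite mem_cat xp.
Qed.

(* The unique simple path from the root, without its starting point: its size
   counts the edges. *)
Definition root_path v : seq T := xget [::] [set p | simple_path root p v].

Definition depth v : nat := size (root_path v).

(* The neighbour of [v] closest to the root; meaningful only for [v != root]. *)
Definition parent v : T :=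
  xget root [set w | adj v w /\ forall u, adj v u -> (depth w <= depth u)%N].

Lemma depthE v p : simple_path root p v -> depth v = size p.
Proof.
move=> pv; rewrite /depth /root_path; congr size.
by case: xgetP => [q _ qv|/(_ p)//]; exact: simple_path_uniq qv pv.
Qed.

Lemma simple_path_rcons v q w : simple_path root (rcons q w) v ->
  simple_path root q (last root q) /\ adj v (last root q).
Proof.
rewrite /simple_path last_rcons rcons_path -rcons_cons rcons_uniq.
by case=> /andP[pq a] /andP[_ uq] <-; rewrite adj_sym.
Qed.

Lemma adj_depth u v : adj u v ->
  depth u = (depth v).+1 \/ depth v = (depth u).+1.
Proof.
move=> uv; have [p pu] := simple_path_ex root u.
have [vp|vp] := boolP (v \in root :: p); last first.
  right; rewrite (depthE pu) (@depthE _ (rcons p v)) ?size_rcons//.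
  case: pu => pp up lp; split; rewrite ?last_rcons// ?rcons_path ?pp ?lp ?uv//.
  by rewrite -rcons_cons rcons_uniq vp.
left; case/splitPl: vp pu => p1 p2 p1v pu.
have p1s : simple_path root p1 v.
  case: pu; rewrite cat_path -cat_cons cat_uniq => /andP[? _] /andP[? _] _.
  by split.
have p2s : simple_path v p2 u.
  case: pu; rewrite cat_path p1v last_cat p1v => /andP[_ p2p] up lp; split=> //.
  move: up; rewrite -cat_cons lastI cat_rcons p1v.
  by rewrite cat_uniq => /and3P[].
have vu : simple_path v [:: u] u.
  split=> //=; first by rewrite adj_sym uv.
  rewrite inE andbT; apply: contraTneq uv => ->.
  by rewrite adj_irr.
rewrite (depthE pu) (depthE p1s) (simple_path_uniq p2s vu).
by rewrite size_cat addn1.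
Qed.

Lemma parent_uniq u w v : adj v u -> adj v w ->
  depth v = (depth u).+1 -> depth v = (depth w).+1 -> u = w.
Proof.
suff H x : adj v x -> depth v = (depth x).+1 ->
    forall p, simple_path root p v -> x = last root (belast root p).
  move=> vu vw du dw; have [p pv] := simple_path_ex root v.
  by rewrite (H u vu du p pv) (H w vw dw p pv).
move=> vx dx p pv; have [q qx] := simple_path_ex root x.
suff qv : simple_path root (rcons q v) v.
  rewrite (simple_path_uniq pv qv) belast_rcons.
  by case: qx => _ _ /= ->.
case: (qx) => pq uq lq; split; rewrite ?last_rcons ?rcons_path ?pq ?lq 1?adj_sym ?vx//.
rewrite -rcons_cons rcons_uniq uq andbT; apply/negP => vq.
have : (depth v <= size q)%N.
  case/splitPl: vq pq uq {qx lq} => p1 p2 p1v.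
  rewrite cat_path -cat_cons cat_uniq => /andP[pp _] /andP[up _].
  by rewrite (@depthE v p1) // size_cat leq_addr.
by rewrite dx (depthE qx) ltnn.
Qed.

Lemma parentP v : v != root ->
  adj v (parent v) /\ depth v = (depth (parent v)).+1.
Proof.
move=> v0; have [w vw dw] : exists2 w, adj v w & depth v = (depth w).+1.
  have [p pv] := simple_path_ex root v.
  case/lastP: p pv => [[_ _ /= rv]|q x pv]; first by rewrite rv eqxx in v0.
  have [qs a] := simple_path_rcons pv.
  by exists (last root q); rewrite // (depthE pv) (depthE qs) size_rcons.
rewrite /parent; case: xgetP => [u _ [vu umin]|/(_ w) []].
  split=> //; case: (adj_depth vu) => // du.
  by have := umin _ vw; rewrite du dw => /ltnW; rewrite ltnn.
split=> // u vu; case: (adj_depth vu) => du; last first.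
  by rewrite du dw -addn2 leq_addr.
by rewrite -ltnS -du dw.
Qed.

Lemma depth_root : depth root = 0%N.
Proof. by rewrite (@depthE _ [::]). Qed.

End TreeDistance.
Arguments root_path {T}.

(* Selects the weighted Lipschitz space or its little subspace. *)
Variant lip_kind := Lw | Lw0.

Section WeightedLipschitz.
Variables (R : realType) (T : rooted_tree).
Implicit Types (f g : T -> R[i]) (v : T).

Definition lip_diff f v : R := normc (f v - f (parent v)).

Definition weighted_diff f v : R := (depth v)%:R * lip_diff f v.

Definition weighted_diffs f : set R :=
  [set weighted_diff f v | v in [set v | v != root]].

(* The filter of the limit [|v| -> oo]. *)
Definition tree_infty : set_system T :=
  filter_from setT (fun N => [set v | (N <= depth v)%N]).

#[global] Instance tree_infty_filter : Filter tree_infty.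
Proof.
apply: filter_from_filter; first by exists 0%N.
by move=> m n _ _; exists (maxn m n) => // v /=; rewrite geq_max => /andP[].
Qed.

Definition in_Lw f : Prop := has_ubound (weighted_diffs f).

Definition in_Lw0 f : Prop :=
  in_Lw f /\ weighted_diff f @ tree_infty --> (0 : R).

Definition lip_norm f : R := normc (f root) + sup (weighted_diffs f).

Lemma weighted_diff_ge0 f v : 0 <= weighted_diff f v.
Proof. by rewrite mulr_ge0 ?ler0n// /lip_diff; case: (_ - _) => a b; exact: sqrtr_ge0. Qed.

Lemma weighted_diff0 v : weighted_diff (0 : T -> R[i]) v = 0.
Proof. by rewrite /weighted_diff /lip_diff subr0 normc0 mulr0. Qed.

Lemma weighted_diffD f g v :
  weighted_diff (f + g) v <= weighted_diff f v + weighted_diff g v.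
Proof.
rewrite -mulrDr ler_wpM2l ?ler0n// /lip_diff.
by rewrite !fctE opprD addrACA le_normcD.
Qed.

Lemma weighted_diffZ a f v :
  weighted_diff (a *: f) v = normc a * weighted_diff f v.
Proof. by rewrite /weighted_diff /lip_diff !fctE -scalerBr normcM mulrCA. Qed.

Lemma le_lip_sup f v : in_Lw f -> v != root ->
  weighted_diff f v <= sup (weighted_diffs f).
Proof. by move=> fb v0; apply: ub_le_sup => //; exists v. Qed.

Lemma tree_has_nonroot : exists v : T, v != root.
Proof.
apply: contrapT => H; apply: (@tree_infinite T).
have -> : [set: T] = [set root]; last exact: finite_set1.
apply/seteqP; split=> v //= _; apply: contrapT => /eqP v0.
by apply: H; exists v.
Qed.

Lemma weighted_diffs_neq0 f : weighted_diffs f !=set0.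
Proof. by have [v v0] := tree_has_nonroot; exists (weighted_diff f v), v. Qed.

Lemma lip_supZ a f : in_Lw f ->
  sup (weighted_diffs (a *: f)) = normc a * sup (weighted_diffs f).
Proof.
move=> fb.
have a0 : 0 <= normc a by case: (a) => x y; exact: sqrtr_ge0.
have le b g : in_Lw g ->
    sup (weighted_diffs (b *: g)) <= normc b * sup (weighted_diffs g).
  move=> gb; apply: ge_sup; first exact: weighted_diffs_neq0.
  move=> _ [v v0 <-]; rewrite weighted_diffZ ler_wpM2l ?le_lip_sup//.
  by case: (b) => x y; exact: sqrtr_ge0.
apply/eqP; rewrite eq_le le//=.
have [->|an0] := eqVneq a 0.
  rewrite normc0 mul0r; have [v v0] := tree_has_nonroot.
  apply: (le_trans (weighted_diff_ge0 (0 *: f) v)); apply: ub_le_sup; last by exists v.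
  by exists 0 => _ [u _ <-]; rewrite weighted_diffZ normc0 mul0r.
have na0 : 0 < normc a.
  by rewrite lt_neqAle a0 andbT eq_sym; apply: contra an0 => /eqP/eq0_normc ->.
rewrite -ler_pdivlMl// -normcV -[f in X in X <= _](scalerK an0).
apply: le; case: fb => M fM; exists (normc a * M) => _ [v v0 <-].
by rewrite weighted_diffZ ler_wpM2l//; apply: fM; exists v.
Qed.

Lemma eq_parent_root f : (forall v, v != root -> f v = f (parent v)) ->
  forall v, f v = f root.
Proof.
move=> H v; have [n] := ubnP (depth v); elim: n v => // n IH v.
have [->//|v0] := eqVneq v root.
by have [_ ->] := parentP v0; rewrite ltnS H// => /IH.
Qed.

Definition in_lip (k : lip_kind) f : Prop :=
  match k with Lw => in_Lw f | Lw0 => in_Lw0 f end.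

Lemma in_lip_Lw k f : in_lip k f -> in_Lw f.
Proof. by case: k => // -[]. Qed.

Definition lip_pred (k : lip_kind) : {pred T -> R[i]} :=
  fun f => `[< in_lip k f >].

Lemma in_LwD f g : in_Lw f -> in_Lw g -> in_Lw (f + g).
Proof.
move=> [M fM] [N gN]; exists (M + N) => _ [v v0 <-].
by apply: le_trans (weighted_diffD f g v) (lerD _ _); [apply: fM|apply: gN]; exists v.
Qed.

Lemma in_LwZ a f : in_Lw f -> in_Lw (a *: f).
Proof.
move=> [M fM]; exists (normc a * M) => _ [v v0 <-].
rewrite weighted_diffZ ler_wpM2l//; last by apply: fM; exists v.
by case: (a) => x y; exact: sqrtr_ge0.
Qed.

Lemma lip_submod k : submod_closed (lip_pred k).
Proof.
have Lw_0 : in_Lw 0 by exists 0 => _ [v _ <-]; rewrite weighted_diff0.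
split.
  apply/asboolP; case: k => //=; split=> //.
  rewrite (_ : weighted_diff 0 = cst 0); first exact: cvg_cst.
  by apply/funext => v; exact: weighted_diff0.
move=> a f g /asboolP fk /asboolP gk; apply/asboolP.
have fgb : in_Lw (a *: f + g).
  by apply: in_LwD; [apply: in_LwZ|]; apply: in_lip_Lw; eassumption.
case: k fk gk => //= -[_ f0] [_ g0]; split=> //.
apply: (@squeeze_cvgr _ _ _ _ (cst 0)
    (fun v => normc a * weighted_diff f v + weighted_diff g v)).
- apply: nearW => v; rewrite weighted_diff_ge0/=.
  by rewrite -weighted_diffZ weighted_diffD.
- exact: cvg_cst.
- rewrite -[X in _ --> X]addr0 -[X in _ --> X + _](mulr0 (normc a)).
  by apply: cvgD => //; exact: cvgMr.
Qed.

End WeightedLipschitz.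

Record lip (R : realType) (T : rooted_tree) (k : lip_kind) := Lip {
  lip_fun :> T -> R[i];
  lip_funP : lip_fun \in lip_pred k
}.

Section LipschitzSpace.
Variables (R : realType) (T : rooted_tree) (k : lip_kind).
Local Notation X := (lip R T k).

HB.instance Definition _ := [isSub for @lip_fun R T k].
HB.instance Definition _ := [Choice of X by <:].
HB.instance Definition _ := GRing.isSubmodClosed.Build R[i] (T -> R[i])
  (@lip_pred R T k) (@lip_submod R T k).
HB.instance Definition _ := [SubChoice_isSubLmodule of X by <:].

(* Norms on a module over [R[i]] take their values in [R[i]]. *)
Definition lip_normC (f : X) : R[i] := (lip_norm f)%:C.

Lemma lip_in_Lw (f : X) : in_Lw f.
Proof. by case: f => f fk; apply: (@in_lip_Lw _ _ k); apply/asboolP. Qed.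

Lemma lip_normCD f g : lip_normC (f + g) <= lip_normC f + lip_normC g.
Proof.
rewrite /lip_normC -rmorphD lecR /lip_norm addrACA lerD ?le_normcD//.
apply: ge_sup; first exact: weighted_diffs_neq0.
move=> _ [v v0 <-]; apply: le_trans (weighted_diffD f g v) _.
by apply: lerD; apply: le_lip_sup => //; exact: lip_in_Lw.
Qed.

Lemma lip_normCZ (a : R[i]) f : lip_normC (a *: f) = `|a| * lip_normC f.
Proof.
rewrite /lip_normC (_ : `|a| = (normc a)%:C)//.
rewrite -rmorphM /lip_norm mulrDr; congr (_ + _)%:C; first exact: normcM.
by rewrite -lip_supZ//; exact: lip_in_Lw.
Qed.

Lemma lip_normC_eq0 f : lip_normC f = 0 -> f = 0.
Proof.
move=> [/eqP]; have sge v : v != root -> 0 <= weighted_diff f v <= sup (weighted_diffs f).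
  by move=> v0; rewrite weighted_diff_ge0 le_lip_sup//; exact: lip_in_Lw.
have rge : 0 <= normc (f root) by case: (f root) => x y; exact: sqrtr_ge0.
have [u u0] := tree_has_nonroot T.
rewrite paddr_eq0//; last by have /andP[/le_trans] := sge _ u0; apply.
move=> /andP[/eqP/eq0_normc fr /eqP s0].
apply/val_inj/funext => v /=; rewrite (@eq_parent_root _ _ f) ?fr// => w w0.
apply/eqP; rewrite -subr_eq0; apply/eqP/eq0_normc.
have := sge _ w0; rewrite s0 -eq_le eq_sym /weighted_diff mulf_eq0 pnatr_eq0.
by have [_ ->] := parentP w0; move=> /= /eqP.
Qed.

HB.instance Definition _ :=
  Lmodule_isNormed.Build R[i] X lip_normCD lip_normCZ lip_normC_eq0.

Definition is_mul_operator (psi : T -> R[i]) (M : X -> X) : Prop :=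
  forall f v, M f v = psi v * f v.

End LipschitzSpace.

(* Main.v *)
(* The indicator of a vertex [v] lies in both spaces and is an eigenvector of
   the operator for [psi v]; this gives the point spectrum and, a bounded inverse
   of [M - l] forcing [|psi v - l|] away from 0, the closure inside the spectrum.
   Conversely, if [c = psi - l] satisfies [|c| >= e > 0], then
     f(v)/c(v) - f(w)/c(w) = (1/c(w) + 1/c(v)) (f(v) - f(w))
                             - (c(v) f(v) - c(w) f(w)) / (c(v) c(w)),
   so that division by [c] is controlled by [f] and [(M - l) f] alone, without
   the growth condition on [psi] that characterises bounded multipliers. *)
From HB Require Import structures.
Require Import Defs.
From mathcomp Require Import all_boot all_order all_algebra.
From mathcomp Require Import all_classical all_reals all_analysis.
From mathcomp Require Import complex.
From mathcomp Require Import ring.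
Import numFieldNormedType.Exports.
Local Open Scope classical_set_scope.
Local Open Scope ring_scope.
Local Open Scope complex_scope.
Import Order.TTheory GRing.Theory Num.Theory.
Import complex.ComplexField.Normc.

Set Implicit Arguments.
Unset Strict Implicit.
Unset Printing Implicit Defensive.

Lemma normc_ge0 (R : rcfType) (z : R[i]) : 0 <= normc z.
Proof. by case: z => x y; exact: sqrtr_ge0. Qed.

Section WeightedLipschitzFacts.
Variables (R : realType) (T : rooted_tree).
Implicit Types (f g h : T -> R[i]) (k : lip_kind) (v : T).

(** Serves both spaces at once: the domination bounds the weighted differences of [g], and in the
    little space it also squeezes them to 0. It will be applied with [g] a quotient, [f] the
    function divided and [h] its image under [M - l]. *)
Lemma in_lip_le k f g h (a b : R) : 0 <= a -> 0 <= b ->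
  in_lip k f -> in_lip k h ->
  (forall v, weighted_diff g v <= a * weighted_diff f v + b * weighted_diff h v) ->
  in_lip k g.
Proof.
move=> a0 b0 fk hk gle.
have gw : in_Lw g.
  have [F Ff] := in_lip_Lw fk; have [H Hh] := in_lip_Lw hk.
  exists (a * F + b * H) => _ [v v0 <-]; apply: (le_trans (gle v)).
  by apply: lerD; apply: ler_wpM2l => //; [apply: Ff|apply: Hh]; exists v.
case: k fk hk => //= -[_ f0] [_ h0]; split=> //.
apply: (@squeeze_cvgr _ _ _ _ (cst 0)
    (fun v => a * weighted_diff f v + b * weighted_diff h v)).
- by apply: nearW => v; rewrite weighted_diff_ge0 gle.
- exact: cvg_cst.
- rewrite -[X in _ --> X]addr0 -[X in _ --> X + _](mulr0 a) -[X in _ --> _ + X](mulr0 b).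
  by apply: cvgD; exact: cvgMl_tmp.
Qed.

Lemma lip_sup_le f g h (a b : R) : 0 <= a -> 0 <= b -> in_Lw f -> in_Lw h ->
  (forall v, weighted_diff g v <= a * weighted_diff f v + b * weighted_diff h v) ->
  sup (weighted_diffs g) <=
    a * sup (weighted_diffs f) + b * sup (weighted_diffs h).
Proof.
move=> a0 b0 fw hw gle; apply: ge_sup; first exact: weighted_diffs_neq0.
move=> _ [v v0 <-]; apply: (le_trans (gle v)).
by apply: lerD; apply: ler_wpM2l => //; exact: le_lip_sup.
Qed.

Lemma lip_sup_ge0 f : in_Lw f -> 0 <= sup (weighted_diffs f).
Proof.
move=> fw; have [v v0] := tree_has_nonroot T.
exact: le_trans (weighted_diff_ge0 f v) (le_lip_sup fw v0).
Qed.

Definition vertex_indicator v : T -> R[i] := fun u => (u == v)%:R.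

(** Only [v] and its children see a jump of the indicator, and their depth is at most
    [depth v + 1]. *)
Lemma weighted_diff_indicator_eq0 v u :
  ((depth v).+1 < depth u)%N -> weighted_diff (vertex_indicator v) u = 0.
Proof.
move=> vu; rewrite /weighted_diff /lip_diff /vertex_indicator.
have u0 : u != Defs.root by apply: contraTneq vu => ->; rewrite depth_root.
have [_ du] := parentP u0.
have -> : (u == v) = false.
  by apply/negbTE; apply: contraTneq vu => ->; rewrite ltnNge leqnSn.
have -> : (parent u == v) = false.
  by apply/negbTE; apply: contraTneq vu => <-; rewrite du ltnn.
by rewrite subrr normc0 mulr0.
Qed.

Lemma weighted_diff_indicator_le v u :
  weighted_diff (vertex_indicator v) u <= (depth v).+1%:R.
Proof.
have [vu|uv] := ltnP (depth v).+1 (depth u).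
  by rewrite weighted_diff_indicator_eq0// ler0n.
rewrite /weighted_diff -[leRHS]mulr1; apply: ler_pM; rewrite ?ler0n ?ler_nat//.
  exact: normc_ge0.
rewrite /lip_diff /vertex_indicator -lecR.
change (`|(u == v)%:R - (parent u == v)%:R : R[i]| <= 1).
by case: (u == v); case: (parent u == v);
  rewrite ?subrr ?subr0 ?sub0r ?normrN ?normr0 ?normr1 ?ler01.
Qed.

Lemma in_lip_indicator k v : in_lip k (vertex_indicator v).
Proof.
have w : in_Lw (vertex_indicator v).
  by exists (depth v).+1%:R => _ [u _ <-]; exact: weighted_diff_indicator_le.
case: k => //=; split=> //; apply: cvg_near_cst.
(* The first depth strictly below all children of [v]. *)
exists (depth v).+2 => // u /= vu.
exact: weighted_diff_indicator_eq0.
Qed.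

Definition lip_indicator k v : lip R T k :=
  Lip (introT (asboolP _) (in_lip_indicator k v)).

Lemma lip_indicator_neq0 k v : lip_indicator k v != 0.
Proof.
apply/negP => /eqP/(congr1 (fun f : lip R T k => f v)) /=.
by rewrite /vertex_indicator eqxx => /eqP; rewrite oner_eq0.
Qed.

Lemma weighted_diff_div f g (c : T -> R[i]) (e : R) : 0 < e ->
  (forall v, e <= normc (c v)) -> (forall v, g v = c v * f v) ->
  forall v, weighted_diff (fun u => (c u)^-1 * f u) v <=
    2 * e^-1 * weighted_diff f v + e^-1 ^+ 2 * weighted_diff g v.
Proof.
move=> e0 ce gE v.
rewrite /weighted_diff mulrCA [X in _ + X]mulrCA -mulrDr ler_wpM2l ?ler0n//.
rewrite /lip_diff; set w := parent v.
have cn0 u : c u != 0.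
  by apply: contraTneq (ce u) => ->; rewrite normc0 -ltNge.
have icn u : normc (c u)^-1 <= e^-1.
  rewrite normcV lef_pV2 ?posrE//; exact: lt_le_trans (ce u).
have -> : (c v)^-1 * f v - (c w)^-1 * f w =
    ((c w)^-1 + (c v)^-1) * (f v - f w) + - ((c v)^-1 * (c w)^-1) * (g v - g w).
  by rewrite !gE; field; rewrite !cn0.
apply: (le_trans (le_normcD _ _)); rewrite !normcM.
(* Each inverse has modulus at most [e^-1]: their sum yields the constant [2 * e^-1], their product
   [e^-1 ^+ 2]. *)
apply: lerD; apply: ler_wpM2r; rewrite ?normc_ge0//.
  by apply: (le_trans (le_normcD _ _)); rewrite mulrDl !mul1r lerD.
by rewrite normcN normcM expr2 ler_pM ?normc_ge0.
Qed.

End WeightedLipschitzFacts.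

(** Balls in [R[i]] have complex radii, but a positive complex number is real, so real radii
    suffice. *)
Lemma closure_normP (R : realType) (A : set R[i]) (l : R[i]) :
  closure A l <-> forall e : R, 0 < e -> exists2 a, A a & normc (a - l) < e.
Proof.
split=> [Al e e0|H B].
  have [|a [Aa la]] := Al (ball l e%:C).
    by apply: nbhsx_ballx; rewrite ltcR.
  exists a => //; rewrite -ltcR.
  by move: la; rewrite -ball_normE /= distrC.
case/nbhs_ballP => e /= e0 lB.
have eE : e = (complex.Re e)%:C by case: e e0 {lB} => x y /andP[/eqP /= -> _].
have [|a Aa al] := H (complex.Re e); first by rewrite -ltcR -eE.
exists a; split=> //; apply: lB.
by rewrite -ball_normE /= distrC eE -ltcR in al *.
Qed.

Section MultiplicationOperator.
Variables (R : realType) (T : rooted_tree) (k : lip_kind).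
Variables (psi : T -> R[i]) (M : {linear lip R T k -> lip R T k}).
Hypothesis M_psi : is_mul_operator psi M.

Lemma mul_operator_indicator v :
  M (lip_indicator R k v) = psi v *: lip_indicator R k v.
Proof.
apply/val_inj/funext => u; rewrite [LHS]M_psi /= /vertex_indicator.
change (psi u * (u == v)%:R = psi v * (u == v)%:R).
by have [->|] := eqVneq u v; rewrite ?mulr0.
Qed.

Lemma mul_operator_subE l f v : (M f - l *: f) v = (psi v - l) * f v.
Proof. by rewrite mulrBl -M_psi. Qed.

Lemma point_spectrum_mul_operator : point_spectrum M = range psi.
Proof.
apply/seteqP; split=> l.
  case=> f f0 Mf; apply: contrapT => lpsi; move/negP: f0; apply; apply/eqP.
  apply/val_inj/funext => v.
  have /eqP : (psi v - l) * f v = 0 by rewrite -mul_operator_subE Mf.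
  rewrite mulf_eq0 subr_eq0 => /orP[/eqP pl|/eqP//].
  by case: lpsi; exists v.
case=> v _ <-; exists (lip_indicator R k v); first exact: lip_indicator_neq0.
by rewrite mul_operator_indicator subrr.
Qed.

(** If [C] bounds an inverse of [M - l], testing it on the eigenvector at [v] gives
    [1 <= C * |psi v - l|] for every [v], so no value of [psi] comes closer to [l] than [1 / C]. *)
Lemma closure_sub_spectrum : closure (range psi) `<=` spectrum M.
Proof.
move=> l /closure_normP lpsi [S' [C SC] [SK _]].
have Cpsi v : 1 <= C * `|psi v - l|.
  set d := lip_indicator R k v.
  have d0 : 0 < `|d| by rewrite normr_gt0 lip_indicator_neq0.
  have := SC (M d - l *: d); rewrite SK mul_operator_indicator -scalerBl.
  by rewrite normrZ mulrA -[X in X <= _]mul1r ler_pM2r.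
(* [C] is a priori an arbitrary complex number; the bound at the root makes it positive, hence
   real. *)
have C0 : 0 < C.
  have p0 : 0 < `|psi Defs.root - l|.
    rewrite normr_gt0; apply: contraTneq (Cpsi Defs.root) => ->.
    by rewrite normr0 mulr0 ler10.
  by rewrite -(pmulr_lgt0 _ p0) (lt_le_trans ltr01).
have CE : C = (complex.Re C)%:C by rewrite RRe_real// gtr0_real.
have [|_ [v _ <-] vl] := lpsi (complex.Re C)^-1.
  by rewrite invr_gt0 -ltcR -CE.
suff /lt_geF : C * `|psi v - l| < 1 by rewrite Cpsi.
by rewrite -ltr_pdivlMl// mulr1 CE -fmorphV ltcR.
Qed.

Lemma mul_operator_subK l (e : R) : bounded_operator M -> 0 < e ->
  (forall v, e <= normc (psi v - l)) ->
  invertible_operator (fun f => M f - l *: f).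
Proof.
move=> [C MC] e0 epsi; pose S f := M f - l *: f.
have ei0 : 0 <= e^-1 by rewrite invr_ge0 ltW.
have a0 : 0 <= 2 * e^-1 by rewrite mulr_ge0.
have b0 : 0 <= e^-1 ^+ 2 by rewrite exprn_ge0.
pose q (f : lip R T k) v := (psi v - l)^-1 * f v.
have qle f v : weighted_diff (q f) v <=
    2 * e^-1 * weighted_diff f v + e^-1 ^+ 2 * weighted_diff (S f) v.
  by apply: weighted_diff_div epsi _ v => // v; exact: mul_operator_subE.
have in_f (f : lip R T k) : in_lip k f by case: f => f fk; apply/asboolP.
(* Membership of [S f] is used here: [M] maps the space into itself. *)
have qk f : q f \in lip_pred k.
  exact/asboolP/(in_lip_le a0 b0 (in_f f) (in_f (S f)) (qle f)).
pose Q f := Lip (qk f).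
have cn0 v : psi v - l != 0.
  by apply: contraTneq (epsi v) => ->; rewrite normc0 -ltNge.
have SK : cancel S Q.
  move=> f; apply/val_inj/funext => v /=.
  by rewrite /q mul_operator_subE mulKf.
have QK : cancel Q S.
  move=> f; apply/val_inj/funext => v.
  by rewrite [LHS]mul_operator_subE /= /q mulVKf.
have Qlin : linear Q.
  move=> a f g; apply/val_inj/funext => v /=.
  change ((psi v - l)^-1 * (a * f v + g v) =
    a * ((psi v - l)^-1 * f v) + (psi v - l)^-1 * g v).
  by rewrite mulrDr mulrCA.
pose QL : {linear lip R T k -> lip R T k} :=
  HB.pack Q (GRing.isLinear.Build _ _ _ _ Q Qlin).
exists QL => //.
(* The two coefficients of [qle], with the norm of [S f] bounded by [C + |l|] times that of [f]. *)
exists ((2 * e^-1)%:C + (e^-1 ^+ 2)%:C * (C + `|l|)) => f.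
have Sf : `|S f| <= (C + `|l|) * `|f|.
  by rewrite mulrDl -normrZ (le_trans (ler_normB _ _)) ?lerD.
apply: (@le_trans _ _ ((2 * e^-1)%:C * `|f| + (e^-1 ^+ 2)%:C * `|S f|)); last first.
  by rewrite [leRHS]mulrDl lerD2l -mulrA ler_wpM2l// lecR.
change ((lip_norm (q f))%:C <=
  (2 * e^-1)%:C * (lip_norm f)%:C + (e^-1 ^+ 2)%:C * (lip_norm (S f))%:C).
rewrite -!rmorphM -rmorphD lecR /lip_norm !mulrDr addrACA lerD//; last first.
  by apply: lip_sup_le (qle f) => //; exact: lip_in_Lw.
(* At the root the [f] term alone suffices, as [e^-1 <= 2 * e^-1]; the [S f] term is only
   nonnegative slack. *)
rewrite /q normcM -[leLHS]addr0 lerD ?mulr_ge0 ?normc_ge0//.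
rewrite ler_wpM2r ?normc_ge0// normcV.
apply: (@le_trans _ _ e^-1).
  by rewrite lef_pV2 ?posrE//; exact: lt_le_trans (epsi Defs.root).
by rewrite ler_peMl// ler1n.
Qed.

Lemma spectrum_sub_closure :
  bounded_operator M -> spectrum M `<=` closure (range psi).
Proof.
(* A radius [e] within which [psi] takes no value is exactly the uniform lower bound that makes
   [M - l] invertible. *)
move=> Mb l lM; apply/closure_normP => e e0; apply: contrapT => H.
apply: lM; apply: (mul_operator_subK Mb e0) => v.
by rewrite leNgt; apply/negP => lt; apply: H; exists (psi v) => //; exists v.
Qed.

End MultiplicationOperator.

Theorem theorem6p1 (R : realType) (T : rooted_tree) (k : lip_kind)
    (psi : T -> R[i]) (M : {linear lip R T k -> lip R T k})
    (M_psi : is_mul_operator psi M) (M_bounded : bounded_operator M) :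
  point_spectrum M = range psi /\ spectrum M = closure (range psi).
Proof.
split; first exact: point_spectrum_mul_operator.
apply/seteqP; split; first exact: spectrum_sub_closure.
exact: closure_sub_spectrum.
Qed.
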